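(* Let $E$ be a continuous signature, let $X$ be a semitopological $E$-algebra, let $Y$ be a dense subalgebra of $X$, and let $p,q\in\mathsf T(E)$ be terms. Suppose that $\Omega(p)(v)\le 1$ and $\Omega(q)(v)\le 1$ for all variables $v\in\mathbb V$, that is, each variable appears at most once in $p$ and at most once in $q$. If the identity $p\approx q$ holds for $Y$, then the identity $p\approx q$ holds for $X$.
   Context: All spaces are Tychonoff. A continuous signature is a space $E$ that is the disjoint union of clopen (possibly empty) subsets $E_n$, $n\in\omega=\{0,1,2,\dots\}$. An $E$-algebra is a set $X$ with maps $\mathfrak e^X_n\colon E_n\times X^n\to X$, $n\in\omega$ ($X^0$ is a singleton); for $f\in E_n$ put $f^X(\bar x)=\mathfrak e^X_n(f,\bar x)$. A semitopological $E$-algebra is an $E$-algebra endowed with a topology such that every $\mathfrak e^X_n$ is separately continuous, i.e. continuous in each of its $n+1$ arguments when the others are fixed. A subalgebra is a subset closed under all operations $f^X$ (including constants, $f\in E_0$), with the restricted structure. Let $\mathbb V=\{\mathsf v_1,\mathsf v_2,\dots\}$ be a countable set of variables disjoint from $E$. The set $\mathsf T(E)$ of terms is the smallest set containing $\mathbb V\cup E_0$ and such that $f(t_1,\dots,t_m)\in\mathsf T(E)$ whenever $f\in E_m$ and $t_1,\dots,t_m\in\mathsf T(E)$. For a term $t$, $\mathrm{vars}\,t$ is the set of variables occurring in $t$, and $\Omega(t)(v)$ is the number of occurrences of the variable $v$ in $t$. For $\mathrm{vars}\,t\subset R\subset\mathbb V$ and $\bar x=(x_v)_{v\in R}\in X^R$,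 $t^X(\bar x)\in X$ is the value of $t$ obtained by substituting $x_v$ for $v$ and evaluating with the operations of $X$. The identity $p\approx q$ holds for $X$ if $p^X(\bar x)=q^X(\bar x)$ for all $\bar x\in X^R$, where $R=\mathrm{vars}\,p\cup\mathrm{vars}\,q$. *)

(* Defs.v *)
From mathcomp Require Import all_boot all_order all_algebra.
From mathcomp Require Import all_classical all_reals all_analysis.

Set Implicit Arguments.
Unset Strict Implicit.
Unset Printing Implicit Defensive.

Local Open Scope classical_set_scope.

Definition tychonoff_space (T : topologicalType) : Prop :=
  completely_regular_space T /\ hausdorff_space T.

Record continuous_signature := ContinuousSignature {
  sig_space :> topologicalType;
  sig_tychonoff : tychonoff_space sig_space;
  sig_arity : nat -> set sig_space;
  sig_clopen : forall n, clopen (sig_arity n);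
  sig_disjoint : trivIset [set: nat] sig_arity;
  sig_cover : \bigcup_n sig_arity n = [set: sig_space]
}.

Arguments sig_arity : clear implicits.

(* [sig_arity E n] in type position is the subtype [set_type (sig_arity E n)],
   which carries the topology induced from [E]; [X^n] is ['I_n -> X]. *)
Definition algebra_on (E : continuous_signature) (X : Type) : Type :=
  forall n : nat, sig_arity E n -> ('I_n -> X) -> X.

Record semitopological_algebra (E : continuous_signature) :=
  SemitopologicalAlgebra {
  alg_space :> topologicalType;
  alg_tychonoff : tychonoff_space alg_space;
  alg_op : algebra_on E alg_space;
  alg_op_continuous_sig : forall (n : nat) (x : 'I_n -> alg_space),
    continuous (fun f : sig_arity E n => alg_op f x);
  alg_op_continuous_arg :
    forall (n : nat) (f : sig_arity E n) (x : 'I_n -> alg_space) (i : 'I_n),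
    continuous (fun y : alg_space => alg_op f (dfwith x i y))
}.

Definition is_subalgebra (E : continuous_signature) (X : Type)
    (op : algebra_on E X) (Y : set X) : Prop :=
  forall (n : nat) (f : sig_arity E n) (x : 'I_n -> X),
    (forall i, Y (x i)) -> Y (op n f x).

Definition subalgebra_op (E : continuous_signature) (X : Type)
    (op : algebra_on E X) (Y : set X) (HY : is_subalgebra op Y) :
    algebra_on E Y :=
  fun n f y => SigSub (mem_set
    (HY n f (fun i => set_val (y i)) (fun i => set_mem (valP (y i))))).

(* The variable v_{k+1} is [Var k]; a constant [f] in [E_0] is [App f x] for the
   unique [x : 'I_0 -> term E]. *)
Inductive term (E : continuous_signature) : Type :=
  | Var : nat -> term E
  | App : forall n : nat, sig_arity E n -> ('I_n -> term E) -> term E.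

Arguments Var {E}.

Fixpoint vars (E : continuous_signature) (t : term E) : set nat :=
  match t with
  | Var v => [set v]
  | App n f ts => \bigcup_(i in [set: 'I_n]) vars (ts i)
  end.

Fixpoint occ (E : continuous_signature) (t : term E) (v : nat) : nat :=
  match t with
  | Var w => w == v
  | App n f ts => \sum_(i < n) occ (ts i) v
  end.

Lemma vars_App (E : continuous_signature) (n : nat) (f : sig_arity E n)
    (ts : 'I_n -> term E) (R : set nat) (i : 'I_n) :
  vars (App f ts) `<=` R -> vars (ts i) `<=` R.
Proof. by move=> H v Hv; apply: H; exists i. Qed.

(* The value t^X(x) for x in X^R, defined when vars t is contained in R. *)
Fixpoint eval (E : continuous_signature) (X : Type) (op : algebra_on E X)
    (R : set nat) (x : R -> X) (t : term E) : vars t `<=` R -> X :=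
  match t return vars t `<=` R -> X with
  | Var v => fun H => x (SigSub (mem_set (H v erefl)))
  | App n f ts => fun H => op n f (fun i => eval op x (t := ts i) (vars_App (i := i) H))
  end.

Definition identity_holds (E : continuous_signature) (X : Type)
    (op : algebra_on E X) (p q : term E) : Prop :=
  forall x : (vars p `|` vars q) -> X,
    eval op x (@subsetUl _ (vars p) (vars q)) =
    eval op x (@subsetUr _ (vars p) (vars q)).

(* Main.v *)
(* Since each variable occurs at most once in a term, the value of the term as a
   function of one variable is a composition of maps obtained by fixing all but
   one argument of an operation, hence it is continuous.  Two continuous maps
   into a Hausdorff space that agree on a dense set are equal, so the arguments
   of the identity can be moved from [Y] to [X] one at a time. *)
Require Import Defs.
From mathcomp Require Import all_boot all_order all_algebra.
From mathcomp Require Import all_classical all_reals all_analysis.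

Lemma eq_on_dense (T U : topologicalType) (D : set T) (f g : T -> U) :
  hausdorff_space U -> dense D -> continuous f -> continuous g ->
  (forall x, D x -> f x = g x) -> f = g.
Proof.
(* Hausdorffness enters in cluster form: two points are equal once any neighbourhoods [A] and [B] of
   them meet. *)
move=> hU dD cf cg fg; apply/funext => x; apply: hU => A B nA nB.
have nAB : nbhs x (f @^-1` A `&` g @^-1` B)%classic.
  by apply: filterI; [exact: cf | exact: cg].
have [||y [/interior_subset[Ay By] Dy]] := dD (interior (f @^-1` A `&` g @^-1` B)%classic).
- by exists x.
- exact: open_interior.
- by exists (f y); split => //; rewrite fg.
Qed.

Lemma dfwith_id (I : eqType) (T : I -> Type) (f : forall i, T i) (i : I) :
  dfwith f i (f i) = f.
Proof. by apply/functional_extensionality_dep => j; case: dfwithP. Qed.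

(* [eval] takes assignments on a subset of the variables; total assignments have
   a type independent of the term, which allows changing one variable at a time. *)
Fixpoint evalT (E : continuous_signature) (X : Type) (op : algebra_on E X)
    (x : nat -> X) (t : term E) : X :=
  match t with
  | Var v => x v
  | App n f ts => op n f (fun i => evalT E X op x (ts i))
  end.
Arguments evalT {E X}.

Lemma eval_evalT (E : continuous_signature) (X : Type) (op : algebra_on E X)
    (R : set nat) (x : R -> X) (x' : nat -> X) (t : term E)
    (tR : (vars t `<=` R)%classic) :
  (forall r : R, x r = x' (set_val r)) -> Defs.eval op x tR = evalT op x' t.
Proof.
move=> xx'; elim: t tR => [v|n f ts IH] tR /=; first by rewrite xx'.
by congr (op n f _); apply/funext => i; exact: IH.
Qed.

Lemma evalT_subalgebra (E : continuous_signature) (X : Type)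
    (op : algebra_on E X) (Y : set X) (HY : is_subalgebra op Y)
    (y : nat -> Y) (t : term E) :
  set_val (evalT (subalgebra_op HY) y t) = evalT op (fun v => set_val (y v)) t.
Proof.
elim: t => [//|n f ts IH] /=.
by congr (op n f _); apply/funext => i; exact: IH.
Qed.

(** Guarantees that moving the variables from [Y] to [X] one at a time ends after finitely many
    steps. *)
Lemma vars_bounded (E : continuous_signature) (t : term E) :
  exists n, forall v, vars t v -> v < n.
Proof.
elim: t => [v|n f ts /choice[b bP]]; first by exists v.+1 => w ->.
exists (\max_(i < n) b i) => v [i _ /bP vb].
by apply: (leq_trans vb); exact: leq_bigmax.
Qed.

Lemma evalT_dfwith_nocc (E : continuous_signature) (X : Type)
    (op : algebra_on E X) (x : nat -> X) (v : nat) (z : X) (t : term E) :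
  occ t v = 0 -> evalT op (dfwith x v z) t = evalT op x t.
Proof.
elim: t => [w|n f ts IH] /=.
  by case: (eqVneq w v) => // wv _; rewrite dfwithout // eq_sym.
move=> /eqP; rewrite sum_nat_eq0 => /forallP occ0.
by congr (op n f _); apply/funext => i; apply/IH/eqP/occ0.
Qed.

Lemma continuous_evalT (E : continuous_signature) (X : semitopological_algebra E)
    (x : nat -> X) (v : nat) (t : term E) :
  occ t v <= 1 ->
  continuous (fun z : X => evalT (@alg_op E X) (dfwith x v z) t).
Proof.
elim: t => [w|n f ts IH] /=.
  move=> _; have [<-|vw] := eqVneq v w.
    rewrite (_ : (fun _ => _) = id); first by move=> z; exact: cvg_id.
    by apply/funext => z; rewrite dfwithin.
  rewrite (_ : (fun _ => _) = cst (x w)); first exact: cst_continuous.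
  by apply/funext => z; rewrite dfwithout.
move=> occ1.
have [/forallP occ0|/forallPn[i occi]] := boolP [forall i, occ (ts i) v == 0].
  rewrite (_ : (fun _ => _) =
      cst (alg_op f (fun i => evalT (@alg_op E X) x (ts i)))).
    exact: cst_continuous.
  apply/funext => z /=; congr (alg_op f _); apply/funext => i.
  by apply: evalT_dfwith_nocc; apply/eqP.
rewrite (bigD1 i) //= in occ1.
(* The argument [ts i] already uses up the single occurrence of [v], so all other arguments do not
   depend on [z]. *)
have occj j : j != i -> occ (ts j) v = 0.
  move=> ji; rewrite (bigD1 j) //= in occ1.
  by move: occ1 occi; case: (occ (ts i) v) (occ (ts j) v) => [|[|?]] [].
rewrite (_ : (fun _ => _) =
    (fun y => alg_op f (dfwith (fun j => evalT (@alg_op E X) x (ts j)) i y)) \o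
    (fun z => evalT (@alg_op E X) (dfwith x v z) (ts i))).
  move=> z; apply: continuous_comp; last exact: alg_op_continuous_arg.
  by apply: IH; apply: leq_trans occ1; exact: leq_addr.
apply/funext => z /=; congr (alg_op f _); apply/funext => j.
have [->|ji] := eqVneq j i; first by rewrite dfwithin.
by rewrite dfwithout 1?eq_sym// evalT_dfwith_nocc// occj.
Qed.

(** Induction on [n], the number of variables released from [Y]: those with index below [n] range
    over all of [X], the others still over [Y]. *)
Lemma evalT_eq_dense (E : continuous_signature) (X : semitopological_algebra E)
    (Y : set X) (p q : term E) (n : nat) :
  dense Y -> (forall v, occ p v <= 1) -> (forall v, occ q v <= 1) ->
  (forall x : nat -> X, (forall v, Y (x v)) ->
     evalT (@alg_op E X) x p = evalT (@alg_op E X) x q) ->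
  forall x : nat -> X, (forall v, n <= v -> Y (x v)) ->
    evalT (@alg_op E X) x p = evalT (@alg_op E X) x q.
Proof.
move=> dY occp occq idY; elim: n => [x Yx|n IH x Yx].
  by apply: idY => v; exact: Yx.
(* Let only the variable [n] vary. For [z] in [Y] the modified assignment lies in [Y] from index [n]
   on, so the induction hypothesis applies; density covers the remaining [z], in particular
   [x n]. *)
have /(congr1 (@^~ (x n))) : (fun z => evalT (@alg_op E X) (dfwith x n z) p) =
    (fun z => evalT (@alg_op E X) (dfwith x n z) q).
  apply: (@eq_on_dense _ _ Y) => //; try exact: continuous_evalT.
    by have [] := alg_tychonoff X.
  move=> z Yz; apply: IH => v; case: dfwithP => // w nw nlew.
  by apply: Yx; rewrite ltn_neqAle nw.
by rewrite dfwith_id.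
Qed.

Theorem theorem10 :
  forall (E : continuous_signature) (X : semitopological_algebra E)
    (Y : set X) (HY : is_subalgebra (@alg_op E X) Y) (p q : term E),
    dense Y ->
    (forall v : nat, occ p v <= 1) ->
    (forall v : nat, occ q v <= 1) ->
    identity_holds (subalgebra_op HY) p q ->
    identity_holds (@alg_op E X) p q.
Proof.
move=> E X Y HY p q dY occp occq idY x.
(* The point [y0] of [Y] serves as default value for the variables outside [p] and [q]; density
   provides it once [X] is nonempty. *)
have [||y0 [_ Yy0]] := dY setT; first 2 last.
- pose x' v := if pselect ((vars p `|` vars q)%classic v) is left h
    then x (SigSub (mem_set h)) else y0.
  have xx' r : x r = x' (set_val r).
    rewrite /x'; case: pselect => [h|[]]; last exact: set_mem (valP r).
    by congr x; exact: val_inj.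
  rewrite !(eval_evalT _ _ _ _ _ x') //.
  have [[np Hp] [nq Hq]] := (vars_bounded _ p, vars_bounded _ q).
  (* From index [maxn np nq] on no variable occurs in [p] or [q], so [x'] takes there the value [y0]
     in [Y]. *)
  apply: (evalT_eq_dense _ _ Y p q (maxn np nq)) => //.
    move=> z Yz; pose y v : Y := SigSub (mem_set (Yz v)).
    have := idY (fun r => y (set_val r)).
    rewrite !(eval_evalT _ _ _ _ _ y) // => /(congr1 set_val).
    by rewrite !evalT_subalgebra.
  move=> v; rewrite geq_max => /andP[vp vq]; rewrite /x'.
  case: pselect => // h; exfalso.
  by case: h => [/Hp|/Hq]; rewrite ltnNge ?vp ?vq.
(* The value of [p] at [x] is a point of [X] even if neither term has variables. *)
- by exists (Defs.eval (@alg_op E X) x (@subsetUl _ (vars p) (vars q))).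
- exact: openT.
Qed.
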